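(* Let $k$ be a positive integer and let $T_k=([k],E)$ be the transitive tournament with $E=\{(i,j)\in[k]^2: i<j\}$. If $e=(i,j)\in E$ is an edge with $j-i\neq 2$, then the digraph $T_k\setminus\{e\}=([k],E\setminus\{e\})$ has the tournament Sidorenko property.
   Context: All digraphs are oriented graphs (no loops, no antiparallel edges). A tournament is an orientation of a complete graph without loops. For digraphs $D,T$, $h_D(T)$ is the number of maps $\phi:V(D)\to V(T)$ with $(\phi(x),\phi(y))\in E(T)$ for all $(x,y)\in E(D)$, and $t_D(T)=h_D(T)/v(T)^{v(D)}$. A digraph $D$ has the tournament Sidorenko property if $t_D(T)\ge (1-o(1))2^{-e(D)}$ for all tournaments $T$, where $o(1)\to 0$ as the number of vertices of $T$ tends to infinity. *)

(* Defs.v *)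
From HB Require Import structures.
From mathcomp Require Import all_boot all_order all_algebra.
From mathcomp Require Import all_classical all_reals all_analysis.

Set Implicit Arguments.
Unset Strict Implicit.
Unset Printing Implicit Defensive.

Import Order.TTheory GRing.Theory Num.Theory.
Import numFieldNormedType.Exports.

Local Open Scope classical_set_scope.
Local Open Scope ring_scope.

(* A finite digraph is a relation D : rel V on a finType V of vertices. *)

Definition oriented_graph (V : finType) (D : rel V) : Prop :=
  irreflexive D /\ forall x y : V, D x y -> ~~ D y x.

Definition tournament (W : finType) (T : rel W) : Prop :=
  oriented_graph T /\ forall x y : W, x != y -> T x y || T y x.

Definition num_edges (V : finType) (D : rel V) : nat :=
  #|[pred p : V * V | D p.1 p.2]|.

Definition hom_count (V W : finType) (D : rel V) (T : rel W) : nat :=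
  #|[pred phi : {ffun V -> W} |
      [forall x, forall y, D x y ==> T (phi x) (phi y)]]|.

Definition hom_density (R : realType) (V W : finType)
    (D : rel V) (T : rel W) : R :=
  (hom_count D T)%:R / #|W|%:R ^+ #|V|.

(* The error term o depends on D and on the number of vertices of T only, so
   the bound is uniform over all tournaments of a given order. *)
Definition tournament_sidorenko (R : realType) (V : finType) (D : rel V)
    : Prop :=
  exists o : nat -> R,
    o n @[n --> \oo] --> (0 : R) /\
    forall (W : finType) (T : rel W), tournament T ->
      (1 - o #|W|) * 2 ^- num_edges D <= hom_density R D T.

(* The vertex set [k] is represented by 'I_k, i.e. shifted to {0, ..., k-1};
   the order and the differences j - i are unaffected. *)
Definition transitive_tournament (k : nat) : rel 'I_k :=
  fun x y => (x < y)%N.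

Definition delete_edge (V : finType) (D : rel V) (e : V * V) : rel V :=
  fun x y => D x y && ((x, y) != e).

Lemma transitive_tournamentP (k : nat) : tournament (@transitive_tournament k).
Proof.
rewrite /transitive_tournament; split; first split.
- by move=> x; rewrite ltnn.
- by move=> x y xy; rewrite -leqNgt ltnW.
- by move=> x y; rewrite -neq_ltn.
Qed.

Lemma oriented_delete_edge (V : finType) (D : rel V) (e : V * V) :
  oriented_graph D -> oriented_graph (delete_edge D e).
Proof.
rewrite /delete_edge => -[irrD asymD]; split=> [x|x y /andP[/asymD Dyx _]].
  by rewrite irrD.
by rewrite (negbTE Dyx).
Qed.

(* Main.v *)
(* For a subset A of a tournament, bound the number of copies of D inside A from
   below by 2^-e(D) (|A| - c)_+^v(D). Such a bound survives adding a source (or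
   a sink) to D: sum it over the out-neighbourhoods (in-neighbourhoods) in A of
   the vertices of A and use convexity of (t - c)_+^n, the average degree being
   (|A| - 1) / 2. Starting from the empty digraph this gives all transitive
   tournaments, and it reduces the deletion of (i, j) to the case where i is the
   source and j the sink. With m vertices between them, the copies of D are
   then counted by summing, over all pairs (x, y), the copies of T_m among the
   c(x, y) inner vertices of the paths x -> w -> y, so one needs
   sum c(x, y)^m >= n^2 (n / 4)^m up to lower order terms. For m = 0 this is
   trivial; for m >= 2 it follows by the power mean inequality from m = 2, which
   is the bound |M^2|^2 >= n^4 / 16 on the Frobenius norm of the square of the
   adjacency matrix M, up to its diagonal equal to (J + S) / 2 with J the
   all-ones matrix and S skew-symmetric. *)

Require Import Defs.
From mathcomp Require Import all_boot all_order all_algebra.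
From mathcomp Require Import all_classical all_reals all_analysis.
From mathcomp Require Import ring lra.

Set Implicit Arguments.
Unset Strict Implicit.
Unset Printing Implicit Defensive.

Import Order.TTheory GRing.Theory Num.Theory.
Local Open Scope ring_scope.

(** * Tangent-line and power-mean inequalities *)

Section Inequalities.
Variable R : realFieldType.
Implicit Types (a p K q : R).

Lemma expr_tangent n a p : 0 <= a -> 0 <= p ->
  p ^+ n.+1 + n.+1%:R * p ^+ n * (a - p) <= a ^+ n.+1.
Proof.
move=> a0 p0; elim: n => [|n IHn]; first by rewrite !expr1 expr0; lra.
rewrite [a ^+ _]exprS; apply: le_trans (ler_wpM2l a0 IHn).
rewrite -subr_ge0.
suff -> : a * (p ^+ n.+1 + n.+1%:R * p ^+ n * (a - p)) -
  (p ^+ n.+2 + n.+2%:R * p ^+ n.+1 * (a - p)) =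
  n.+1%:R * p ^+ n * (a - p) ^+ 2.
  by rewrite mulr_ge0 ?sqr_ge0 // mulr_ge0 ?ler0n ?exprn_ge0.
by rewrite !exprS -[n.+2]addn1 natrD; ring.
Qed.

(* The tangent bound for [t ^ ((n + 2) / 2)] at [t = p ^ 2], read at
   [t = a ^ 2]. *)
Lemma expr_tangent_sqr n a p : 0 <= a -> 0 <= p ->
  p ^+ n.+2 + n.+2%:R / 2 * p ^+ n * (a ^+ 2 - p ^+ 2) <= a ^+ n.+2.
Proof.
move=> a0 p0; elim: n => [|n IHn]; first by rewrite expr0; lra.
rewrite [a ^+ _]exprS; apply: le_trans (ler_wpM2l a0 IHn).
rewrite -subr_ge0.
suff -> : a * (p ^+ n.+2 + n.+2%:R / 2 * p ^+ n * (a ^+ 2 - p ^+ 2)) -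
  (p ^+ n.+3 + n.+3%:R / 2 * p ^+ n.+1 * (a ^+ 2 - p ^+ 2)) =
  p ^+ n * (a - p) ^+ 2 * (n.+2%:R * a + n.+1%:R * p) / 2.
  rewrite divr_ge0 ?ler0n // mulr_ge0 //.
    by rewrite mulr_ge0 ?sqr_ge0 ?exprn_ge0.
  by rewrite addr_ge0 // mulr_ge0 ?ler0n.
rewrite -[n.+3]addn3 -[n.+2]addn2 -[n.+1]addn1 !natrD !exprD; by field.
Qed.

Lemma sumr_const_natl (I : finType) (P : pred I) p :
  \sum_(i | P i) p = #|P|%:R * p.
Proof. by rewrite sumr_const mulr_natl. Qed.

(** Summing the tangent bound at [p] leaves a linear term that is nonnegative as soon as [p] is at
    most the average. *)
Lemma power_mean_ge (I : finType) (P : pred I) (f : I -> R) n p :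
  (forall i, P i -> 0 <= f i) -> 0 <= p ->
  #|P|%:R * p <= \sum_(i | P i) f i ->
  #|P|%:R * p ^+ n <= \sum_(i | P i) f i ^+ n.
Proof.
move=> f0 p0 avg; case: n => [|n].
  by rewrite expr0 (eq_bigr _ (fun i _ => expr0 (f i))) sumr_const_natl.
have := ler_sum (index_enum I) (fun i Pi => expr_tangent n (f0 i Pi) p0).
apply: le_trans; rewrite big_split /= sumr_const_natl lerDl.
rewrite -mulr_sumr mulr_ge0 // ?mulr_ge0 ?ler0n ?exprn_ge0 //.
by rewrite sumrB sumr_const_natl subr_ge0.
Qed.

Lemma power_mean_sqr_ge (I : finType) (P : pred I) (f : I -> R) n p :
  (forall i, P i -> 0 <= f i) -> 0 <= p ->
  #|P|%:R * p ^+ 2 <= \sum_(i | P i) f i ^+ 2 ->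
  #|P|%:R * p ^+ n.+2 <= \sum_(i | P i) f i ^+ n.+2.
Proof.
move=> f0 p0 avg.
have := ler_sum (index_enum I) (fun i Pi => expr_tangent_sqr n (f0 i Pi) p0).
apply: le_trans; rewrite big_split /= sumr_const_natl lerDl.
rewrite -mulr_sumr mulr_ge0 // ?mulr_ge0 ?divr_ge0 ?ler0n ?exprn_ge0 //.
by rewrite sumrB sumr_const_natl subr_ge0.
Qed.

(* A reverse triangle inequality in L2, freed of square roots. *)
Lemma sum_sqr_shift_ge (I : finType) (P : pred I) (f g : I -> R) K q :
  0 <= K -> K <= q ->
  (forall i, P i -> 0 <= g i <= f i + K) ->
  #|P|%:R * q ^+ 2 <= \sum_(i | P i) g i ^+ 2 ->
  #|P|%:R * (q - K) ^+ 2 <= \sum_(i | P i) f i ^+ 2.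
Proof.
move=> K0; rewrite le_eqVlt => /predU1P[->|Kq] gf gq.
  by rewrite subrr expr0n mulr0 sumr_ge0 // => i _; exact: sqr_ge0.
have p0 : 0 < q - K by lra.
have q0 : 0 < q by lra.
(* A weighted form of [(f + K)^2], with the weights chosen so that equality holds at [f = q - K]. *)
have gle i : P i ->
    (q - K) * g i ^+ 2 <= q * f i ^+ 2 + K * (q - K) * q.
  move=> /gf/andP[g0 gle].
  have g2 : g i ^+ 2 <= (f i + K) ^+ 2.
    by rewrite ler_pXn2r // nnegrE; lra.
  apply: le_trans (ler_wpM2l (ltW p0) g2) _; rewrite -subr_ge0.
  suff -> : q * f i ^+ 2 + K * (q - K) * q - (q - K) * (f i + K) ^+ 2 =
    K * (f i - (q - K)) ^+ 2 by rewrite mulr_ge0 ?sqr_ge0.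
  ring.
have := ler_sum (index_enum I) gle.
rewrite -mulr_sumr big_split /= -mulr_sumr sumr_const_natl => le1.
have le2 := le_trans (ler_wpM2l (ltW p0) gq) le1.
rewrite -(ler_pM2l q0); move: le2; rewrite -lerBlDr; apply: le_trans.
by rewrite le_eqVlt; apply/orP; left; apply/eqP; ring.
Qed.

End Inequalities.

(** * The Frobenius norm of [(J + S)^2] *)

Section SkewSymmetric.
Variables (R : realFieldType) (W : finType) (A : {set W}) (S : W -> W -> R).
Hypothesis skewS : forall x y, S y x = - S x y.

Let r x := \sum_(w in A) S x w.
Let q x y := \sum_(w in A) S x w * S w y.
Let n : R := #|A|%:R.

Lemma skew_row_sum0 : \sum_(x in A) r x = 0.
Proof.
suff : \sum_(x in A) r x = - \sum_(x in A) r x by lra.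
transitivity (\sum_(x in A) \sum_(w in A) S w x); first exact: exchange_big.
rewrite -sumrN; apply: eq_bigr => x _.
by rewrite /r -sumrN; apply: eq_bigr => w _; rewrite skewS.
Qed.

(* For skew-symmetric [S] and the all-ones matrix [J], the Frobenius norm
   satisfies [|(J + S)^2|^2 = n^4 + |S^2|^2]. *)
Lemma skew_square_ge :
  n ^+ 4 <= \sum_(x in A) \sum_(y in A)
    (\sum_(w in A) (1 + S x w) * (1 + S w y)) ^+ 2.
Proof.
have qC x y : q y x = q x y.
  by apply: eq_bigr => w _; rewrite (skewS w y) (skewS x w); ring.
have uE x y : \sum_(w in A) (1 + S x w) * (1 + S w y) =
    (n + q x y) + (r x - r y).
  rewrite /n /q /r -sumr_const -big_split /= -sumrB -big_split /=.
  by apply: eq_bigr => w _; rewrite (skewS w y); ring.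
(* [q] is the matrix [S^2]; since [S] is skew, its column sums are the negatives of its row sums
   [r]. *)
have sumq : \sum_(x in A) \sum_(y in A) q x y = - \sum_(x in A) r x ^+ 2.
  rewrite /q (eq_bigr _ (fun x _ => exchange_big _ _ _ _ _ _)) /=.
  rewrite exchange_big /= -sumrN; apply: eq_bigr => w _.
  rewrite expr2 {1}/r mulr_suml -sumrN; apply: eq_bigr => x _.
  by rewrite -mulr_sumr (skewS x w) mulNr opprK.
have sumr : \sum_(x in A) \sum_(y in A) (r x - r y) ^+ 2 =
    2 * n * \sum_(x in A) r x ^+ 2.
  transitivity (\sum_(x in A) (n * r x ^+ 2 + \sum_(y in A) r y ^+ 2)).
    apply: eq_bigr => x _.
    transitivity (\sum_(y in A) (r x ^+ 2 + r y ^+ 2 - 2 * r x * r y)).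
      by apply: eq_bigr => y _; ring.
    by rewrite sumrB -mulr_sumr skew_row_sum0 mulr0 subr0 big_split /=
      sumr_const_natl.
  by rewrite big_split /= -mulr_sumr sumr_const_natl; ring.
(* Exchanging [x] and [y] changes the sign, because [q] is symmetric. *)
have cross : \sum_(x in A) \sum_(y in A) (n + q x y) * (r x - r y) = 0.
  set s := LHS; suff : s = - s by lra.
  transitivity (\sum_(x in A) \sum_(y in A) (n + q y x) * (r y - r x)).
    exact: exchange_big.
  rewrite -sumrN; apply: eq_bigr => x _.
  by rewrite -[RHS]sumrN; apply: eq_bigr => y _; rewrite qC; ring.
(* These summands are the expanded square without [q x y ^+ 2]; by [sumq] and [sumr] all but the
   [n ^+ 2] terms cancel in the total. *)
have -> : n ^+ 4 = \sum_(x in A) \sum_(y in A)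
    (n ^+ 2 + 2 * n * q x y + (r x - r y) ^+ 2 +
     2 * ((n + q x y) * (r x - r y))).
  transitivity (\sum_(x in A) (\sum_(y in A) n ^+ 2 +
      2 * n * \sum_(y in A) q x y + \sum_(y in A) (r x - r y) ^+ 2 +
      2 * \sum_(y in A) (n + q x y) * (r x - r y))).
    rewrite !big_split /= -!mulr_sumr sumq sumr cross.
    by rewrite !sumr_const_natl -/n; ring.
  by apply: eq_bigr => x _; rewrite !mulr_sumr -!big_split.
apply: ler_sum => x _; apply: ler_sum => y _; rewrite uE -subr_ge0.
set u := q x y; set v := r x - r y.
suff -> : (n + u + v) ^+ 2 -
  (n ^+ 2 + 2 * n * u + v ^+ 2 + 2 * ((n + u) * v)) = u ^+ 2.
  exact: sqr_ge0.
ring.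
Qed.

End SkewSymmetric.

(** * Counting homomorphisms by the image of one vertex *)

Section HomCount.
Variables (W : finType) (T : rel W).

(* Homomorphisms [D -> T] with prescribed lists [A v] of allowed images; unlike
   plain homomorphism counts these are stable under fixing the image of a
   vertex. *)
Definition hom_list (V : finType) (D : rel V) (A : V -> {set W})
    : pred {ffun V -> W} :=
  [pred phi : {ffun V -> W} | [forall v, phi v \in A v] &&
    [forall x, forall y, D x y ==> T (phi x) (phi y)]].

Definition insert_ffun n (v : 'I_n.+1) (x : W) (phi : {ffun 'I_n -> W})
    : {ffun 'I_n.+1 -> W} :=
  [ffun u => if unlift v u is Some u' then phi u' else x].

Lemma insert_ffun_inj n (v : 'I_n.+1) :
  injective (fun p : W * {ffun 'I_n -> W} => insert_ffun v p.1 p.2).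
Proof.
move=> [x phi] [y psi] /= /ffunP eq_ins; congr (_, _).
  by have := eq_ins v; rewrite !ffunE unlift_none.
by apply/ffunP => u; have := eq_ins (lift v u); rewrite !ffunE liftK.
Qed.

Definition link n (D : rel 'I_n.+1) (v : 'I_n.+1) (x : W) (u : 'I_n)
    : {set W} :=
  [set w | (D v (lift v u) ==> T x w) && (D (lift v u) v ==> T w x)].

(** Fixing the image [x] of [v] turns each edge at [v] into a restriction on the list of its other
    end; distinct choices extend to distinct maps. *)
Lemma hom_list_insert n (D : rel 'I_n.+1) (v : 'I_n.+1)
    (A : 'I_n.+1 -> {set W}) :
  ~~ D v v ->
  (\sum_(x in A v) #|hom_list (fun y z => D (lift v y) (lift v z))
      (fun u => A (lift v u) :&: link D v x u)| <= #|hom_list D A|)%N.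
Proof.
move=> Dvv.
rewrite (eq_bigr _ (fun x _ => esym (sum1_card _))) pair_big_dep /= sum1_card.
rewrite -(card_imset _ (@insert_ffun_inj n v)); apply/subset_leq_card.
apply/fintype.subsetP => _ /imsetP[[x phi] + ->] /=.
rewrite !inE /= => /and3P[Ax /forallP phiA /forallP phiD].
apply/andP; split.
  apply/forallP => u; rewrite ffunE; case: unliftP => [u'|] -> //.
  by have := phiA u'; rewrite inE => /andP[].
apply/forallP => y; apply/forallP => z; apply/implyP; rewrite !ffunE.
case: unliftP => [y'|] ->; case: unliftP => [z'|] -> Dyz.
- by have /forallP/(_ z')/implyP := phiD y'; apply.
- by have := phiA y'; rewrite !inE Dyz => /and3P[].
- by have := phiA z'; rewrite !inE Dyz => /and3P[].
- by rewrite Dyz in Dvv.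
Qed.

Lemma hom_listT (V : finType) (D : rel V) :
  #|hom_list D (fun => [set: W])| = hom_count D T.
Proof.
apply: eq_card => phi; rewrite !inE.
by case: forallP => // -[]v; rewrite inE.
Qed.

End HomCount.

Lemma num_edges_insert n (D : rel 'I_n.+1) (v : 'I_n.+1) : ~~ D v v ->
  num_edges D = (num_edges (fun y z => D (lift v y) (lift v z)) +
    \sum_u (D v (lift v u) + D (lift v u) v))%N.
Proof.
have E m (D' : rel 'I_m) : num_edges D' = (\sum_x \sum_y D' x y)%N.
  rewrite /num_edges -sum1_card pair_bigA /= big_mkcond /=.
  by apply: eq_bigr => p _; rewrite inE; case: (D' _ _).
move=> /negbTE Dvv; rewrite !E (bigD1_ord v) //= (bigD1_ord v) //= Dvv add0n.
rewrite (eq_bigr _ (fun i _ => bigD1_ord v isT)) /= !big_split /=.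
by rewrite addnA addnC.
Qed.

(** * Degree sums in tournaments *)

Section TournamentDegrees.
Variables (W : finType) (T : rel W).
Hypothesis tournT : tournament T.

Lemma tournament_orient (x y : W) : (T x y + T y x)%N = (x != y).
Proof.
have [[irrT asymT] totT] := tournT.
have [->|/totT] := eqVneq x y; first by rewrite irrT.
by case: (boolP (T x y)) => [/asymT/negbTE->|_ /= ->].
Qed.

Lemma tournament_degree_sum (A : {set W}) :
  (2 * \sum_(x in A) #|[set w in A | T x w]| = #|A| * #|A|.-1)%N.
Proof.
have E x : #|[set w in A | T x w]| = (\sum_(w in A) T x w)%N.
  rewrite -sum1_card (eq_bigl [pred w | (w \in A) && T x w]) /=.
    by rewrite big_mkcondr; apply: eq_bigr => w _; case: (T x w).
  by move=> w; rewrite inE.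
rewrite (eq_bigr _ (fun x _ => E x)) mul2n -addnn {2}exchange_big /=.
rewrite -big_split -sum_nat_const; apply: eq_bigr => x Ax /=.
rewrite -big_split /= (eq_bigr _ (fun w _ => tournament_orient x w)).
rewrite (bigD1 x) //= eqxx add0n (cardsD1 x) Ax /= -sum1_card.
rewrite [RHS](eq_bigl [pred w | (w \in A) && (w != x)]).
  by apply: eq_bigr => w /andP[_]; rewrite eq_sym => ->.
by move=> w; rewrite !inE andbC.
Qed.

End TournamentDegrees.

Lemma tournament_rev (W : finType) (T : rel W) :
  tournament T -> tournament (fun x y => T y x).
Proof.
move=> [[irrT asymT] totT]; split; first by split=> // x y; exact: asymT.
by move=> x y xy; rewrite orbC; exact: totT.
Qed.

Lemma tournament_in_degree_sum (W : finType) (T : rel W) (A : {set W}) :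
  tournament T ->
  (2 * \sum_(x in A) #|[set w in A | T w x]| = #|A| * #|A|.-1)%N.
Proof. by move=> /tournament_rev tT; exact: (tournament_degree_sum tT). Qed.

(** * Shifted Sidorenko bounds and adding a source or a sink *)

Section Sidorenko.
Variable R : realFieldType.

(* A quantitative form of the tournament Sidorenko property. The truncated power
   [(t - c)_+ ^ n] is convex in [t], so that it can be averaged over the degrees
   of a tournament. *)
Definition sidorenko_shift n (D : rel 'I_n) (c : R) : Prop :=
  0 <= c /\
  forall (W : finType) (T : rel W) (A : {set W}), tournament T ->
    2 ^- num_edges D * Num.max 0 (#|A|%:R - c) ^+ n <=
      #|hom_list T D (fun => A)|%:R.

(** The new shift comes from the average degree: [(a - 1) / 2 - c = (a - (2 * c + 1)) / 2]. *)
Lemma sidorenko_shift_insert n (D : rel 'I_n.+1) (v : 'I_n.+1) c :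
  ~~ D v v ->
  (forall u, D v (lift v u) && ~~ D (lift v u) v) \/
  (forall u, D (lift v u) v && ~~ D v (lift v u)) ->
  sidorenko_shift (fun y z => D (lift v y) (lift v z)) c ->
  sidorenko_shift D (2 * c + 1).
Proof.
move=> Dvv Duv [c0 sid]; split=> [|W T A tT]; first by lra.
pose N x : {set W} := if [forall u, D v (lift v u) && ~~ D (lift v u) v]
  then [set w in A | T x w] else [set w in A | T w x].
have eN : num_edges D =
    (num_edges (fun y z => D (lift v y) (lift v z)) + n)%N.
  rewrite (num_edges_insert Dvv); congr addn.
  rewrite -[RHS]muln1 -[X in (X * _)%N]card_ord -sum_nat_const.
  by apply: eq_bigr => u _; case: Duv => /(_ u)/andP[-> /negbTE->].
have NS : (2 * \sum_(x in A) #|N x| = #|A| * #|A|.-1)%N.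
  rewrite /N; case: [forall u, _]; first exact: (tournament_degree_sum tT).
  exact: (tournament_in_degree_sum A tT).
have subN x u : N x \subset A :&: link T D v x u.
  rewrite /N; case: ifPn => [/forallP/(_ u)/andP[Dvu Duv']|].
    by apply/fintype.subsetP => w; rewrite !inE Dvu (negbTE Duv') /= andbT.
  case: Duv => [/forallP->//|/(_ u)/andP[Dvu Duv'] _].
  by apply/fintype.subsetP => w; rewrite !inE Dvu (negbTE Duv').
have lb x : x \in A ->
    2 ^- num_edges (fun y z => D (lift v y) (lift v z)) *
      Num.max 0 (#|N x|%:R - c) ^+ n <=
    #|hom_list T (fun y z => D (lift v y) (lift v z))
        (fun u => A :&: link T D v x u)|%:R.
  move=> Ax; apply: le_trans (sid _ _ _ tT) _; rewrite ler_nat.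
  apply/subset_leq_card/fintype.subsetP => phi.
  rewrite !inE => /andP[/forallP phiN ->].
  by rewrite andbT; apply/forallP => u; exact: (fintype.subsetP (subN x u)).
have := hom_list_insert T (fun => A) Dvv; rewrite -(ler_nat R) natr_sum.
apply: le_trans; apply: le_trans (ler_sum _ lb).
rewrite -mulr_sumr eN exprD invfM -mulrA ler_wpM2l ?invr_ge0 ?exprn_ge0 //.
set a : R := #|A|%:R; pose p := Num.max 0 ((a - 1) / 2 - c).
have -> : Num.max 0 (a - (2 * c + 1)) = 2 * p.
  by rewrite /p maxr_pMr // mulr0; congr Num.max; field.
(* The powers of 2 cancel down to [2 * p * p ^+ n], and [2 * p <= a]. *)
apply: (@le_trans _ _ (a * p ^+ n)).
  have -> : 2 ^- n * (2 * p) ^+ n.+1 = 2 * p * p ^+ n.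
    rewrite exprMn !exprS; field.
    by rewrite expf_neq0.
  rewrite ler_wpM2r ?exprn_ge0 ?le_max ?lexx // /p maxr_pMr // mulr0 ge_max.
  by rewrite ler0n /a; lra.
apply: power_mean_ge => [x _||]; rewrite ?le_max ?lexx //.
rewrite -/a.
have NSR : 2 * \sum_(x in A) #|N x|%:R = a * (a - 1) :> R.
  rewrite -natr_sum -natrM NS natrM -/a /a; case: #|A| => [|m].
    by rewrite !mul0r.
  by rewrite -natr1 addrK.
have le_sum : a * ((a - 1) / 2 - c) <=
    \sum_(x in A) Num.max 0 (#|N x|%:R - c).
  apply: (@le_trans _ _ (\sum_(x in A) (#|N x|%:R - c))).
    by rewrite sumrB sumr_const_natl -/a; lra.
  by apply: ler_sum => x _; rewrite le_max lexx orbT.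
rewrite /p maxr_pMr ?ler0n // mulr0 ge_max le_sum andbT.
by apply: sumr_ge0 => x _; rewrite le_max lexx.
Qed.
Lemma hom_list_ord0_gt0 (W : finType) (T : rel W) (D : rel 'I_0) A :
  (0 < #|hom_list T D A|)%N.
Proof.
apply/card_gt0P; exists (ffun0 (card_ord 0)); rewrite inE.
by apply/andP; split; apply/forallP => -[].
Qed.

Lemma sidorenko_shift_transitive m :
  exists c : R, sidorenko_shift (@transitive_tournament m) c.
Proof.
elim: m => [|m [c sid]].
  exists 0; split=> // W T A _; rewrite expr0 mulr1.
  apply: (@le_trans _ _ 1); last by rewrite ler1n hom_list_ord0_gt0.
  by rewrite invf_le1 ?exprn_gt0 // exprn_ege1 // ler1n.
exists (2 * c + 1); apply: (@sidorenko_shift_insert _ _ ord0) => //.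
by left=> u; rewrite /transitive_tournament.
Qed.

(** * Moments of the number of paths of length two *)

Definition inner_paths (W : finType) (T : rel W) (A : {set W}) (x y : W)
    : {set W} := [set w in A | T x w && T w y].

(** The exponent 1 must be excluded: a transitive tournament on [n] vertices has only about
    [n^3 / 6] paths of length two, short of [n^3 / 4]. *)
Lemma inner_paths_moment (W : finType) (T : rel W) (A : {set W}) (c : R) m :
  tournament T -> 0 <= c -> m <> 1%N ->
  #|A|%:R ^+ 2 * Num.max 0 (#|A|%:R / 4 - (c + 1)) ^+ m <=
    \sum_(x in A) \sum_(y in A)
      Num.max 0 (#|inner_paths T A x y|%:R - c) ^+ m.
Proof.
move=> tT c0 m1; set a : R := #|A|%:R; set p := Num.max _ _.
pose f (z : W * W) : R := Num.max 0 (#|inner_paths T A z.1 z.2|%:R - c).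
pose P := [pred z : W * W | (z.1 \in A) && (z.2 \in A)].
have cardP : #|P|%:R = a ^+ 2.
  rewrite expr2 -natrM -cardsX; congr _%:R.
  by apply: eq_card => z; rewrite !inE.
rewrite -cardP.
have f0 z : P z -> 0 <= f z by rewrite /f le_max lexx.
have p0 : 0 <= p by rewrite le_max lexx.
rewrite pair_big /=.
case: m m1 => [|[|m]] // _.
  rewrite expr0 (eq_bigr _ (fun z _ => expr0 (f z))).
  by rewrite sumr_const_natl lexx.
apply: (power_mean_sqr_ge _ f0) => //.
(* The reverse triangle inequality needs the shift [c + 1] to be at most [a / 4]; otherwise
   [p = 0]. *)
have [ap|pa] := leP (a / 4) (c + 1).
  have -> : p = 0 by apply/max_idPl; rewrite subr_le0.
  by rewrite expr0n mulr0 sumr_ge0 // => z _; exact: sqr_ge0.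
have -> : p = a / 4 - (c + 1) by apply/max_idPr; rewrite subr_ge0 ltW.
pose S x y : R := (T x y)%:R - (T y x)%:R.
have skewS x y : S y x = - S x y by rewrite /S opprB.
have SE x w : 1 + S x w = 2 * ((T x w)%:R + (x == w)%:R / 2).
  have := congr1 (fun k => k%:R : R) (tournament_orient tT x w).
  by rewrite natrD /S; case: (x == w) => /=; lra.
(* [(x == w)%:R / 2] fills the diagonal, so that [4 * g z] is the entry of
   [(J + S)^2] at [z]. *)
pose g (z : W * W) : R := \sum_(w in A)
  ((T z.1 w)%:R + (z.1 == w)%:R / 2) * ((T w z.2)%:R + (w == z.2)%:R / 2).
apply: (@sum_sqr_shift_ge _ _ _ f g); first by lra.
- exact: ltW.
- move=> [x y] /andP[/= Ax Ay]; rewrite /g /f /=; apply/andP; split.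
    by apply: sumr_ge0 => w _; rewrite mulr_ge0 ?addr_ge0 ?divr_ge0 ?ler0n.
  (* The diagonal fill adds at most 1/2 at each of [w = x] and [w = y]; the truncation accounts for
     the remaining [c]. *)
  apply: (@le_trans _ _ (#|inner_paths T A x y|%:R + 1)); last first.
    by rewrite addrA lerD2r -lerBlDr le_max lexx orbT.
  have sum_eq x' : x' \in A -> \sum_(w in A) (x' == w)%:R = 1 :> R.
    move=> Ax'; rewrite (bigD1 x') //= eqxx big1 ?addr0 // => w /andP[_].
    by rewrite eq_sym => /negbTE->.
  have -> : #|inner_paths T A x y|%:R + 1 = \sum_(w in A)
      ((T x w && T w y)%:R + (x == w)%:R / 2 + (y == w)%:R / 2) :> R.
    rewrite !big_split /= -!mulr_suml !sum_eq // -addrA -splitr.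
    congr (_ + _); rewrite -sum1_card natr_sum.
    rewrite (eq_bigl [pred w | (w \in A) && (T x w && T w y)]) /=.
      by rewrite big_mkcondr; apply: eq_bigr => w _; case: (T x w && T w y).
    by move=> w; rewrite !inE.
  have irrT : irreflexive T by case: tT => -[].
  apply: ler_sum => w _; rewrite [y == w]eq_sym.
  have : (x == w) ==> ~~ T x w by apply/implyP => /eqP->; rewrite irrT.
  have : (w == y) ==> ~~ T w y by apply/implyP => /eqP->; rewrite irrT.
  by case: (x == w); case: (w == y); case: (T x w); case: (T w y) => //= _ _;
    lra.
have := skew_square_ge A skewS; rewrite pair_big /= -/a.
rewrite (eq_bigr (fun z => 16 * g z ^+ 2)); last first.
  move=> z _; rewrite /g -[16]/((4 * 4)%N%:R) natrM -expr2 -exprMn mulr_sumr.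
  congr (_ ^+ 2); apply: eq_bigr => w _; rewrite !SE; ring.
rewrite -mulr_sumr.
suff -> : #|P|%:R * (a / 4) ^+ 2 = a ^+ 4 / 16 by lra.
by rewrite cardP; field.
Qed.

(* The endpoints are naturals so that deleting a vertex needs no cast. *)
Definition transitive_minus k (a b : nat) : rel 'I_k :=
  fun x y => (x < y)%N && ((x : nat, y : nat) != (a, b)).

(** The ends are not adjacent, so their images [x] and [y] range freely over [A], while the [m]
    middle vertices are confined to [inner_paths T A x y]. *)
Lemma sidorenko_shift_minus_ends m : m <> 1%N ->
  exists c : R, sidorenko_shift (@transitive_minus m.+2 0 m.+1) c.
Proof.
move=> m1; have [c [c0 sid]] := sidorenko_shift_transitive m.
exists (4 * (c + 1)); split=> [|W T A tT]; first by lra.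
set D := @transitive_minus _ _ _.
pose D' : rel 'I_m.+1 := fun y z => D (lift ord_max y) (lift ord_max z).
have DE (x y : 'I_m.+2) :
    D x y = (x < y)%N && ((x : nat, y : nat) != (0, m.+1)%N) by [].
have Dmax : ~~ D ord_max ord_max by rewrite DE ltnn.
have D'0 : ~~ D' ord0 ord0 by rewrite /D' DE ltnn.
have liftE (u : 'I_m) : lift (@ord_max m.+1) (lift ord0 u) = u.+1 :> nat.
  by rewrite lift_max lift0.
have Dm u : D ord_max u = false by rewrite DE ltnNge -ltnS ltn_ord.
have Dlm (u : 'I_m) : D (lift ord_max (lift ord0 u)) ord_max.
  by rewrite DE liftE /= ltnS ltn_ord.
have D0m : D (lift ord_max ord0) ord_max = false.
  by rewrite DE lift_max /= eqxx.
have D'r (u : 'I_m) : D' (lift ord0 u) ord0 = false.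
  by rewrite /D' DE liftE lift_max.
have D'l (u : 'I_m) : D' ord0 (lift ord0 u).
  rewrite /D' DE liftE lift_max /= xpair_eqE negb_and /= eqSS.
  by rewrite (ltn_eqF (ltn_ord u)).
have D'' : (fun y z => D' (lift ord0 y) (lift ord0 z)) =
    @transitive_tournament m.
  apply/funext => y; apply/funext => z; rewrite /D' DE !liftE ltnS.
  by rewrite xpair_eqE andbT.
have eD : num_edges D = (num_edges (@transitive_tournament m) + m + m)%N.
  rewrite (num_edges_insert Dmax) (num_edges_insert D'0) D''.
  congr (_ + _ + _)%N.
    rewrite -[RHS]muln1 -[X in (X * _)%N]card_ord -sum_nat_const.
    by apply: eq_bigr => u _; rewrite D'l D'r.
  rewrite big_ord_recl D0m !Dm add0n.
  rewrite -[RHS]muln1 -[X in (X * _)%N]card_ord -sum_nat_const.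
  by apply: eq_bigr => u _; rewrite Dlm Dm.
have hom_ge : (\sum_(x in A) \sum_(y in A)
    #|hom_list T (@transitive_tournament m) (fun => inner_paths T A x y)| <=
    #|hom_list T D (fun => A)|)%N.
  apply: leq_trans (hom_list_insert T (fun => A) Dmax).
  rewrite exchange_big; apply: leq_sum => y Ay /=.
  apply: leq_trans (hom_list_insert T _ D'0).
  have -> : A :&: link T D ord_max y ord0 = A.
    by apply/setP => w; rewrite !inE D0m Dm /= andbT.
  apply: leq_sum => x Ax; rewrite D''.
  apply/subset_leq_card/fintype.subsetP => phi.
  rewrite !inE => /andP[/forallP phiA ->]; rewrite andbT.
  apply/forallP => u; have := phiA u.
  by rewrite !inE D'l D'r Dlm Dm /= andbT => /and3P[-> -> ->].
move: hom_ge; rewrite -(ler_nat R); apply: le_trans.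
set a : R := #|A|%:R; set p := Num.max 0 (a / 4 - (c + 1)).
have p0 : 0 <= p by rewrite le_max lexx.
have -> : Num.max 0 (a - 4 * (c + 1)) = 4 * p.
  by rewrite /p maxr_pMr // mulr0; congr Num.max; field.
have pa : 4 * p <= a.
  by rewrite /p maxr_pMr // mulr0 ge_max ler0n /a; lra.
(* The [2 * m] edges at the ends cancel [4 ^+ m], and [(4 * p) ^+ 2 <= a ^+ 2]. *)
apply: (@le_trans _ _ (2 ^- num_edges (@transitive_tournament m) *
    (a ^+ 2 * p ^+ m))).
  rewrite eD -addnA exprD invfM -mulrA ler_wpM2l ?invr_ge0 ?exprn_ge0 //.
  have -> : 2 ^- (m + m) * (4 * p) ^+ m.+2 = (4 * p) ^+ 2 * p ^+ m.
    rewrite -[m.+2]addn2 !exprD (_ : 4 = 2 * 2); last by rewrite -natrM.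
    by rewrite !exprMn; field; rewrite expf_neq0.
  by rewrite ler_wpM2r ?exprn_ge0 // ler_pXn2r // nnegrE ?ler0n ?mulr_ge0.
apply: le_trans (ler_wpM2l _ (inner_paths_moment A tT c0 m1)) _.
  by rewrite invr_ge0 exprn_ge0.
rewrite natr_sum mulr_sumr; apply: ler_sum => x _.
by rewrite natr_sum mulr_sumr; apply: ler_sum => y _; exact: sid.
Qed.

(** Vertex 0 is a source when [a > 0], and the last vertex is a sink when it is not [b]. Peeling
    these off keeps [b - a], which ends up as [m + 1], so that [m <> 1]. *)
Lemma sidorenko_shift_minus k (a b : nat) : (a < b < k)%N -> (b - a)%N <> 2%N ->
  exists c : R, sidorenko_shift (@transitive_minus k a b) c.
Proof.
elim: k a b => [|k IHk] a b; first by rewrite andbF.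
case: a => [|a] /andP[ab bk] ab2; last first.
  case: b ab bk ab2 => // b ab bk ab2.
  have [|c sid] := IHk a b _ ab2; first by rewrite -ltnS ab.
  exists (2 * c + 1); apply: (@sidorenko_shift_insert _ _ ord0) => //.
  by left=> u; rewrite /transitive_minus.
move: bk; rewrite ltnS leq_eqVlt => /predU1P[bk|bk].
  case: k b bk ab ab2 {IHk} => [|m] _ -> // _ m2.
  by apply: sidorenko_shift_minus_ends => m1; apply: m2; rewrite m1.
have [|c sid] := IHk 0%N b _ ab2; first by rewrite ab.
exists (2 * c + 1); apply: (@sidorenko_shift_insert _ _ ord_max).
- by rewrite /transitive_minus ltnn.
- right=> u; rewrite /transitive_minus lift_max ltn_ord xpair_eqE.
  by rewrite (gtn_eqF bk) andbF /= ltnNge ltnW ?ltn_ord.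
- congr (sidorenko_shift _ c): sid.
  by apply/funext => y; apply/funext => z; rewrite /transitive_minus !lift_max.
Qed.

End Sidorenko.

(** * From shifted bounds to densities *)

Lemma sidorenko_shift_tournament (R : realType) k (D : rel 'I_k) (c : R) :
  (0 < k)%N -> sidorenko_shift D c -> tournament_sidorenko R D.
Proof.
move=> k0 [c0 sid]; pose K : R := 2 * k%:R * c + 1.
(* As [harmonic n] is [1 / (n + 1)], the factor 2 in [K] absorbs the off-by-one; the summand 1 makes
   [1 - o 0 <= 0], which settles the empty tournament. *)
exists (fun n => K * harmonic n); split.
  by rewrite -(mulr0 K); apply: cvgMl_tmp; exact: cvg_harmonic.
move=> W T tT; have := sid W T [set: W]%SET tT.
rewrite hom_listT /hom_density cardsT card_ord; set a : nat := #|W|.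
move=> le_hom; have {le_hom} := ler_wpM2r (_ : 0 <= (a%:R ^+ k)^-1) le_hom.
rewrite invr_ge0 exprn_ge0 ?ler0n // => /(_ isT); apply: le_trans.
rewrite [_ * 2 ^- _]mulrC -mulrA ler_wpM2l ?invr_ge0 ?exprn_ge0 //.
have kc0 : 0 <= k%:R * c by rewrite mulr_ge0.
case: a => [|n].
  rewrite /= invr1 /K; apply: (@le_trans _ _ 0); first by lra.
  by rewrite mulr_ge0 ?invr_ge0 ?exprn_ge0 ?le_max ?lexx.
rewrite -exprVn -exprMn; set b := Num.max _ _ / _.
have n0 : 0 < n.+1%:R :> R by rewrite ltr0n.
have b0 : 0 <= b by rewrite /b divr_ge0 ?le_max ?lexx ?ler0n.
have bge : 1 - c / n.+1%:R <= b.
  rewrite /b ler_pdivlMr // mulrBl mul1r divfK ?gt_eqF //.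
  by rewrite le_max lexx orbT.
rewrite /= /K {K}; case: k k0 kc0 {sid D} => // k _ kc0.
(* Bernoulli's inequality: the tangent at 1. *)
have := expr_tangent k b0 ler01; rewrite !expr1n mulr1; apply: le_trans.
have : k.+1%:R * (- (c / n.+1%:R)) <= k.+1%:R * (b - 1) :> R.
  by rewrite ler_wpM2l ?ler0n // lerBrDr addrC.
have : k.+1%:R * c / n.+1%:R <= (2 * k.+1%:R * c + 1) / n.+2%:R :> R.
  rewrite ler_pdivrMr // mulrAC ler_pdivlMr ?ltr0n // -[n.+2]addn1 natrD.
  have : 1 <= n.+1%:R :> R by rewrite ler1n.
  set t : R := n.+1%:R => t1; set s := k.+1%:R * c in kc0 *.
  have := mulr_ge0 kc0 (_ : 0 <= t - 1); rewrite subr_ge0 => /(_ t1).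
  by rewrite -[2 * _ * c]mulrA -/s; nra.
rewrite mulrN mulrA => le1 le2; apply: lerD => //.
by apply: le_trans le2; rewrite lerN2.
Qed.

Theorem theorem1p10 (R : realType) (k : nat) (hk : (0 < k)%N) (i j : 'I_k)
    (hij : transitive_tournament i j) (hne : (j - i)%N <> 2%N) :
  tournament_sidorenko R (delete_edge (@transitive_tournament k) (i, j)).
Proof.
have [|c sid] := @sidorenko_shift_minus R k i j _ hne.
  by rewrite ltn_ord andbT.
by apply: (@sidorenko_shift_tournament _ _ _ c).
Qed.
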